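(* Let $n\ge 4$, let $(\mathcal{V},d)$ be a separable metric space, and let $\{(U_i,V_i)\}_{i=1}^n$ be i.i.d. samples drawn from the joint distribution of $(U,V)$, with $U$ real-valued and $V$ taking values in $\mathcal{V}$. Suppose that for each $t\in\{1,\dots,n\}$ the distances $d(V_1,V_t),\dots,d(V_n,V_t)$ are pairwise distinct. For each $t$, order the samples by distance to $V_t$, $$d(V_{(1)t},V_t)<d(V_{(2)t},V_t)<\cdots<d(V_{(n)t},V_t),$$ and let $U_{(i)t}$ be the value of $U$ attached to the sample $V_{(i)t}$. Then $$(n)_4\cdot\widehat{\mathrm{FCCov}}(U\mid V)=\sum_{t=1}^n\sum_{r=1}^n\left[\Big(\sum_{i=1}^{r-1}U_{(i)t}\Big)^2-\sum_{i=1}^{r-1}U_{(i)t}^2-2U_t\cdot\sum_{i=1}^{r-1}U_{(i)t}\right]+2(n-1)\sum_{i=1}^nU_i^2 .$$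
   Context: $(n)_m=n(n-1)\cdots(n-m+1)$. $\mathcal{A}_{n,4}$ is the set of $4$-tuples $(i,j,k,l)\in\{1,\dots,n\}^4$ with pairwise distinct entries. With $\phi(V_1,V_2,V_3)=I[d(V_1,V_3)<d(V_2,V_3)]$ (indicator), the estimator is $$\widehat{\mathrm{FCCov}}(U\mid V)=\frac{1}{(n)_4}\sum_{(i,j,k,l)\in\mathcal{A}_{n,4}}U_iU_j\,\phi(V_i,V_k,V_l)\,\phi(V_j,V_k,V_l).$$ (The paper takes $E[U]=0$ without loss of generality when introducing this estimator.) Empty sums are $0$. *)

(* Defs.v *)
From HB Require Import structures.
From mathcomp Require Import all_boot all_order all_fingroup all_algebra.
From mathcomp Require Import all_classical all_reals all_analysis.

Set Implicit Arguments.
Unset Strict Implicit.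
Unset Printing Implicit Defensive.

Import Order.TTheory GRing.Theory Num.Theory.
Import numFieldNormedType.Exports.

Local Open Scope classical_set_scope.
Local Open Scope ring_scope.

(* Measurable types are pointed in MathComp-Analysis, so a metric space carrying
   its Borel sigma-algebra must be given a point.  This loses nothing: a space
   in which a random element takes values is nonempty. *)
#[short(type="pmetricType")]
HB.structure Definition PointedMetric (K : numDomainType) :=
  { M of Metric K M & isPointed M }.

Notation borelType E := (g_sigma_algebraType (@open E)).

Definition separable (E : topologicalType) : Prop :=
  exists S : set E, countable S /\ dense S.

Section IID.
Context d0 d d' (T0 : measurableType d0) (T : measurableType d)
  (E : measurableType d') (R : realType).

Definition mutually_independent (I : finType) (P : probability T R)
    (X : I -> T -> E) : Prop :=
  forall (J : {set I}) (A : I -> set E), (forall i, measurable (A i)) ->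
    P (\bigcap_(i in [set` J]) (X i @^-1` A i)) =
    (\prod_(i in J) P (X i @^-1` A i))%E.

Definition same_law (P0 : probability T0 R) (X0 : T0 -> E)
    (P : probability T R) (X : T -> E) : Prop :=
  forall A, measurable A -> P (X @^-1` A) = P0 (X0 @^-1` A).

(* [X] is an i.i.d. sample from the law of [X0]; the generic variable [X0] may
   live on another probability space. *)
Definition iid_sample (I : finType) (P0 : probability T0 R) (X0 : T0 -> E)
    (P : probability T R) (X : I -> T -> E) : Prop :=
  mutually_independent P X /\ forall i, same_law P0 X0 P (X i).

End IID.

Section Estimator.
Context (R : realType) (E : metricType R).

Definition phi (v1 v2 v3 : E) : R := (mdist v1 v3 < mdist v2 v3)%R%:R.

Definition FCCov_hat (n : nat) (u : 'I_n -> R) (v : 'I_n -> E) : R :=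
  (n ^_ 4)%:R^-1 *
  \sum_(i < n) \sum_(j < n) \sum_(k < n) \sum_(l < n | uniq [:: i; j; k; l])
    u i * u j * phi (v i) (v k) (v l) * phi (v j) (v k) (v l).

(* [s] lists the indices by increasing distance to [v t].  Positions start at
   [0], so that the paper's $(i)t$ is [s (i - 1)]. *)
Definition distance_order (n : nat) (v : 'I_n -> E) (t : 'I_n) (s : 'S_n) :
    Prop :=
  forall i j : 'I_n, (i < j)%N ->
    mdist (v (s i)) (v t) < mdist (v (s j)) (v t).

Lemma distance_order_exists (n : nat) (v : 'I_n -> E) (t : 'I_n) :
  injective (fun i => mdist (v i) (v t)) -> exists s, distance_order v t s.
Proof.
set f := (fun i => _) => finj.
have rk_lt i : (#|[set j | (f j < f i)%R]%SET| < n)%N.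
  rewrite -[ltnRHS]card_ord -cardsT; apply/proper_card/properP; split.
    exact: finset.subsetT.
  by exists i; rewrite ?finset.in_setT// finset.inE ltxx.
pose rk i : 'I_n := Ordinal (rk_lt i).
have rk_mono i j : f i < f j -> (rk i < rk j)%N.
  move=> fij; apply/proper_card/properP; split.
    by apply/fintype.subsetP => k; rewrite !finset.inE => /lt_trans; apply.
  by exists i; rewrite finset.inE ?ltxx.
have rk_inj : injective rk.
  move=> i j eq_rk; apply: finj; apply/eqP; case: ltgtP => // /rk_mono;
  by rewrite eq_rk ltnn.
exists (perm rk_inj)^-1%g => i j ltij; rewrite -/(f _) -/(f _) ltNge.
apply/negP; rewrite le_eqVlt => /predU1P[/finj /perm_inj ji|/rk_mono].
  by rewrite ji ltnn in ltij.
have rkK k : rk ((perm rk_inj)^-1%g k) = k by rewrite -[RHS](permKV (perm rk_inj)) permE.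
by rewrite !rkK ltnNge (ltnW ltij).
Qed.

End Estimator.

(* Main.v *)
(* Sum over the reference point t = l and the threshold k first.  The product of
   the two indicators restricts i and j to the samples strictly closer to t than
   k, that is to the positions before that of k in the order around t.  Such i
   and j differ from k automatically, so only i <> j and i, j <> t remain to be
   imposed: with S and Q the sums of U and U^2 over those positions, which
   include t as soon as k <> t, this gives
   (S - U_t)^2 - (Q - U_t^2) = S^2 - Q - 2 U_t S + 2 U_t^2.
   The last summand, collected over the n - 1 values k <> t, is the correction
   term; for k = t there is no closer sample and everything vanishes. *)

Require Import Defs.
From mathcomp Require Import all_boot all_order all_fingroup all_algebra.
From mathcomp Require Import all_classical all_reals all_analysis.
From mathcomp Require Import ring.

Set Implicit Arguments.
Unset Strict Implicit.
Unset Printing Implicit Defensive.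

Import Order.TTheory GRing.Theory Num.Theory.
Import numFieldNormedType.Exports.

Local Open Scope classical_set_scope.
Local Open Scope ring_scope.

(** Once [t] is removed from [A], the inner sum is the full sum minus its diagonal term, so the
    total is a squared sum minus a sum of squares. Putting [t] back produces the terms in [u t]. *)
Lemma sum_distinct_pairs_avoiding (R : comPzRingType) (I : finType) (u : I -> R)
    (A : pred I) (t : I) : A t ->
  \sum_(i | A i && (i != t)) \sum_(j | [&& A j, j != t & j != i]) u i * u j =
  (\sum_(i | A i) u i) ^+ 2 - \sum_(i | A i) u i ^+ 2
    - 2 * u t * \sum_(i | A i) u i + 2 * u t ^+ 2.
Proof.
move=> At; have split_t F : \sum_(i | A i) F i =
    F t + \sum_(i | A i && (i != t)) F i :> R by rewrite (bigD1 t).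
rewrite !split_t.
set S := \sum_(i | A i && (i != t)) u i.
have inner i : A i && (i != t) ->
    \sum_(j | [&& A j, j != t & j != i]) u i * u j = u i * S - u i ^+ 2.
  move=> Ai; rewrite -mulr_sumr /S [X in u i * X - _](bigD1 i)//=.
  by under eq_bigl do rewrite andbA; ring.
rewrite (eq_bigr _ inner) sumrB -mulr_suml -/S; ring.
Qed.

Lemma sum_reorder4 (M : nmodType) (I : finType) (F : I -> I -> I -> I -> M) :
  \sum_i \sum_j \sum_k \sum_l F i j k l =
  \sum_l \sum_k \sum_i \sum_j F i j k l.
Proof.
(* Only adjacent sums are swapped: [k] moves to the front, then [l] moves past [j], [i] and [k]. *)
transitivity (\sum_k \sum_i \sum_l \sum_j F i j k l).
  under eq_bigr => i _ do rewrite exchange_big.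
  rewrite exchange_big; apply: eq_bigr => k _; apply: eq_bigr => i _.
  exact: exchange_big.
under eq_bigr => k _ do rewrite exchange_big.
exact: exchange_big.
Qed.

Section DistanceOrder.
Context (R : realType) (E : metricType R) (n : nat) (v : 'I_n -> E) (t : 'I_n).

Lemma distance_order_lt (s : 'S_n) (i j : 'I_n) : distance_order v t s ->
  (mdist (v (s i)) (v t) < mdist (v (s j)) (v t)) = (i < j)%N.
Proof.
move=> s_order; case: (ltngtP i j) => [|ji|/val_inj->]; first exact: s_order.
- by apply/negbTE; rewrite -leNgt ltW// s_order.
- exact: ltxx.
Qed.

(** Bridge between positions in the order around [t] and the strict comparisons tested by [phi]. *)
Lemma sum_before_distance_order (s : 'S_n) (r : 'I_n) (u : 'I_n -> R) :
  distance_order v t s ->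
  \sum_(i < n | (i < r)%N) u (s i) =
  \sum_(i < n | mdist (v i) (v t) < mdist (v (s r)) (v t)) u i.
Proof.
move=> s_order; rewrite [RHS](reindex_inj (@perm_inj _ s)).
by apply: eq_bigl => i; rewrite distance_order_lt.
Qed.

Lemma sum_phi_pairs (u : 'I_n -> R) (k : 'I_n) :
  injective (fun i => mdist (v i) (v t)) ->
  let closer i := mdist (v i) (v t) < mdist (v k) (v t) in
  \sum_(i < n) \sum_(j < n | uniq [:: i; j; k; t])
    u i * u j * phi (v i) (v k) (v t) * phi (v j) (v k) (v t) =
  (\sum_(i | closer i) u i) ^+ 2 - \sum_(i | closer i) u i ^+ 2
    - 2 * u t * (\sum_(i | closer i) u i) + (k != t)%:R * (2 * u t ^+ 2).
Proof.
move=> finj closer; have [kt|k_neq_t] := eqVneq k t.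
  have far i : closer i = false by rewrite /closer kt mdistxx ltNge mdist_ge0.
  rewrite !(big_pred0 _ _ _ _ far) big1 => [|i _]; first by rewrite expr0n/=; ring.
  by apply: big1 => j; rewrite kt /= !inE eqxx !andbF.
(* The distance from [v k] to [v t] is nonzero by [finj], since the value 0 is already taken at
   [t]. *)
have closer_t : closer t.
  rewrite /closer mdistxx lt_neqAle mdist_ge0 andbT eq_sym.
  by apply: contra k_neq_t => /eqP k0; apply/eqP/finj; rewrite /= k0 mdistxx.
rewrite mul1r -sum_distinct_pairs_avoiding// [RHS]big_mkcond.
apply: eq_bigr => i _; rewrite [LHS]big_mkcond.
(* An [i] outside the range contributes zero: [uniq] excludes [i = t], and [phi] vanishes when [i]
   is not closer. *)
have [/andP[ci it]|nci] := ifPn; last first.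
  apply: big1 => j _; case: ifPn => //= /andP[]; rewrite !inE !negb_or.
  move=> /and3P[_ _ it] _; rewrite it andbT in nci.
  by rewrite /phi -/(closer i) (negbTE nci) mulr0 mul0r.
rewrite [RHS]big_mkcond; apply: eq_bigr => j _.
have neq_k x : closer x -> x != k.
  by apply: contraTneq => ->; rewrite /closer ltxx.
rewrite /phi -/(closer i) -/(closer j) ci mulr1 /= !inE !negb_or it neq_k// k_neq_t.
rewrite !andbT; have [cj|_] := boolP (closer j); last first.
  by rewrite mulr0 if_same.
by rewrite neq_k// mulr1 /= andbC [i == j]eq_sym.
Qed.

End DistanceOrder.

Theorem theorem3p3 (R : realType) (E : pmetricType R) (E_sep : separable E)
  (d0 : measure_display) (T0 : measurableType d0) (P0 : probability T0 R)
  (U0 : {RV P0 >-> R}) (V0 : {RV P0 >-> borelType E})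
  (d : measure_display) (T : measurableType d) (P : probability T R)
  (n : nat) (n_ge4 : (4 <= n)%N)
  (U : 'I_n -> {RV P >-> R}) (V : 'I_n -> {RV P >-> borelType E})
  (UV_iid : iid_sample P0 (fun w => (U0 w, V0 w)) P (fun i w => (U i w, V i w)))
  (w : T)
  (dist_distinct :
    forall t, injective (fun i : 'I_n => mdist (V i w : E) (V t w : E)))
  (s : 'I_n -> 'S_n)
  (s_order : forall t, distance_order (fun i => V i w : E) t (s t)) :
  (n ^_ 4)%:R * FCCov_hat (fun i => U i w) (fun i => V i w : E) =
  \sum_(t < n) \sum_(r < n)
     ((\sum_(i < n | (i < r)%N) U (s t i) w) ^+ 2
      - \sum_(i < n | (i < r)%N) U (s t i) w ^+ 2
      - 2 * U t w * \sum_(i < n | (i < r)%N) U (s t i) w)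
  + 2 * (n%:R - 1) * \sum_(i < n) U i w ^+ 2.
Proof.
rewrite /FCCov_hat mulVKf; last first.
  by rewrite pnatr_eq0 -lt0n ffact_gt0.
set u := fun i => U i w; set v := fun i => V i w : E.
transitivity (\sum_(t < n) \sum_(k < n) \sum_(i < n)
    \sum_(j < n | uniq [:: i; j; k; t])
    u i * u j * phi (v i) (v k) (v t) * phi (v j) (v k) (v t)).
  (* The [uniq] condition involves all four indices, so it is moved into the summand before the sums
     are exchanged. *)
  under eq_bigr => i _ do under eq_bigr => j _ do
    under eq_bigr => k _ do rewrite big_mkcond.
  rewrite sum_reorder4; apply: eq_bigr => t _; apply: eq_bigr => k _.
  by apply: eq_bigr => i _; rewrite [RHS]big_mkcond.
rewrite mulr_sumr -big_split/=; apply: eq_bigr => t _.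
under eq_bigr => k _ do rewrite (sum_phi_pairs _ _ (dist_distinct t)).
rewrite big_split/=; congr (_ + _).
  (* The threshold is written [k = s t r], which turns the sum over samples into one over positions
     [r]. *)
  rewrite (reindex_inj (@perm_inj _ (s t)))/=; apply: eq_bigr => r _.
  by rewrite (sum_before_distance_order r u (s_order t))
    (sum_before_distance_order r (fun i => u i ^+ 2) (s_order t)).
rewrite -mulr_suml (bigD1 t)//= eqxx add0r.
under eq_bigr => k k_neq_t do rewrite k_neq_t.
(* The count of [k != t] is a truncated predecessor; it becomes [n%:R - 1] because [1 <= n]. *)
rewrite sumr_const cardC1 card_ord -subn1 natrB ?(leq_trans _ n_ge4)//.
by rewrite mulrCA mulrA.
Qed.
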